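(* There is a function $f$ such that the following holds. Let $G=(V,E)$ be a $d$-bounded graph, let $k\ge 0$ be an integer and let $0<\delta\le 1$. Then $V$ can be partitioned into $r\le f(\delta,d,k)$ subsets $S_1,\dots,S_r$ and a set $T$ such that: (i) for every $i\ne j$ there are no edges between $S_i$ and $S_j$; (ii) $|T|\le\delta d|V|$; (iii) for every $i$ and every nonempty subset $X\subseteq S_i$ with $\phi_G(X)\le\delta^2$ it holds that $\|\mathrm{freq}_k(G,X)-\mathrm{freq}_k(G,S_i)\|_1\le 3\delta$.
   Context: A graph is $d$-bounded if its maximum degree is at most $d$. For $S\subseteq V$, $\phi_G(S)=\frac{e(S,V\setminus S)}{d|S|}$, where $e(S,V\setminus S)$ is the number of edges between $S$ and $V\setminus S$. The $k$-disc of a vertex $v$ is the subgraph of $G$ induced by the vertices at distance at most $k$ from $v$, rooted at $v$ (isomorphism is root-preserving). For a nonempty $S\subseteq V$, $\mathrm{freq}_k(G,S)$ is the vector indexed by isomorphism types $\Delta$ of $k$-discs of $d$-bounded graphs whose $\Delta$-entry is the fraction of vertices of $S$ whose $k$-disc in $G$ is isomorphic to $\Delta$. $\|\cdot\|_1$ is the $\ell_1$-norm. *)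

(* Defs.v *)
From HB Require Import structures.
From mathcomp Require Import all_boot all_order all_algebra.
From mathcomp Require Import boolp reals.

Set Implicit Arguments.
Unset Strict Implicit.
Unset Printing Implicit Defensive.

Import Order.TTheory GRing.Theory Num.Theory.

Local Open Scope ring_scope.

Record graph := Graph {
  vert :> finType;
  adj : rel vert;
  adj_sym : symmetric adj;
  adj_irr : irreflexive adj }.
Arguments adj {g}.

Definition degree (G : graph) (v : G) : nat := #|[set u | adj v u]|.

Definition max_degree (G : graph) : nat := (\max_(v : G) degree v)%N.

Definition bounded (d : nat) (G : graph) : bool := (max_degree G <= d)%N.

Section Induced.
Variables (G : graph) (A : {set G}).

Definition induced_adj : rel {u : G | u \in A} := [rel x y | adj (val x) (val y)].

Fact induced_sym : symmetric induced_adj.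
Proof. by move=> x y; apply: adj_sym. Qed.

Fact induced_irr : irreflexive induced_adj.
Proof. by move=> x; apply: adj_irr. Qed.

Definition induced : graph := Graph induced_sym induced_irr.

End Induced.

Record rgraph := RGraph { rg_graph :> graph; rg_root : rg_graph }.

Definition riso (H K : rgraph) : Prop :=
  exists f : H -> K,
    [/\ bijective f, f (rg_root H) = rg_root K & {mono f : x y / adj x y}].

(* [path adj v p] says that v :: p is a walk, of length [size p]. *)
Definition ball (G : graph) (k : nat) (v : G) : {set G} :=
  [set u | [exists n : 'I_k.+1, [exists p : n.-tuple G,
    path adj v p && (last v p == u)]]].

Fact ball_root (G : graph) (k : nat) (v : G) : v \in ball k v.
Proof.
rewrite inE; apply/existsP; exists ord0; apply/existsP; exists [tuple].
by rewrite /= eqxx.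
Qed.

Definition disc (G : graph) (k : nat) (v : G) : rgraph :=
  @RGraph (induced (ball k v)) (exist _ v (ball_root k v)).

Definition is_disc (d k : nat) (H : rgraph) : Prop :=
  exists (G : graph) (v : G), bounded d G /\ riso (disc k v) H.

(* Isomorphism types of discs form a finite type because a k-disc of a        *)
(* d-bounded graph has at most 1 + d + ... + d ^ k vertices.  Every such disc *)
(* is thus isomorphic to one with vertex set 'I_n for a bounded n, and a type *)
(* is a class of such "codes" modulo isomorphism.  Lemma [disc_type_ex] below *)
(* checks that no disc is left out.                                           *)
Definition disc_size (d k : nat) : nat := (\sum_(i < k.+1) d ^ i)%N.

Section Codes.
Variables (n : nat) (E : {set {set 'I_n}}).

Definition code_adj : rel 'I_n := [rel x y | (x != y) && ([set x; y] \in E)].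

Fact code_sym : symmetric code_adj.
Proof. by move=> x y; rewrite /code_adj /= eq_sym setUC. Qed.

Fact code_irr : irreflexive code_adj.
Proof. by move=> x; rewrite /code_adj /= eqxx. Qed.

Definition code_graph : graph := Graph code_sym code_irr.

End Codes.

(* The number of vertices n, the edges (a set of pairs in 'I_n) and the root. *)
Definition code (N : nat) : finType :=
  {n : 'I_N.+1 & ({set {set 'I_n}} * 'I_n)%type}.

Definition decode (N : nat) (c : code N) : rgraph :=
  @RGraph (code_graph (tagged c).1) (tagged c).2.

Definition disc_classes (d k : nat) : {set {set code (disc_size d k)}} :=
  equivalence_partition
    (fun c c' => `[< riso (decode c) (decode c') >])
    [set c | `[< is_disc d k (decode c) >]].

Definition disc_type (d k : nat) : finType :=
  {D : {set code (disc_size d k)} | D \in disc_classes d k}.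

Definition has_disc_type (G : graph) (d k : nat) (v : G) (D : disc_type d k) :
  Prop := exists2 c, c \in val D & riso (disc k v) (decode c).

Lemma riso_refl (H : rgraph) : riso H H.
Proof. by exists id; split=> //; exists id. Qed.

Lemma riso_sym (H K : rgraph) : riso H K -> riso K H.
Proof.
case=> f [[g fK gK] fr fa]; exists g; split; first by exists f.
- by rewrite -fr fK.
- by move=> x y; rewrite -fa !gK.
Qed.

Lemma riso_trans (H K L : rgraph) : riso H K -> riso K L -> riso H L.
Proof.
case=> f [bf fr fa] [g [bg gr ga]]; exists (g \o f); split.
- exact: bij_comp.
- by rewrite /= fr.
- by move=> x y; rewrite /= ga fa.
Qed.

Lemma disc_classesP (d k : nat) :
  {in [set c : code (disc_size d k) | `[< is_disc d k (decode c) >]] & &,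
    equivalence_rel (fun c c' => `[< riso (decode c) (decode c') >])}.
Proof.
move=> x y z _ _ _; split; first by apply/asboolP; exact: riso_refl.
move=> /asboolP xy; apply/asboolP/asboolP => h.
- exact: riso_trans (riso_sym xy) h.
- exact: riso_trans xy h.
Qed.

Lemma leq_card_disc (d k : nat) (G : graph) (v : G) :
  bounded d G -> (#|disc k v| <= disc_size d k)%N.
Proof.
move=> bG; pose W i := [set u : G | [exists p : i.-tuple G,
  path adj v p && (last v p == u)]].
have degd (w : G) : (#|[set u | adj w u]| <= d)%N.
  by apply: leq_trans bG; apply: (leq_bigmax (F := @degree G)).
have cW i : (#|W i| <= d ^ i)%N.
  elim: i => [|i IH].
    rewrite expn0 -(cards1 v); apply/subset_leq_card/subsetP => u.
    by rewrite !inE => /existsP[p]; rewrite tuple0 /= eq_sym.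
  have sW : W i.+1 \subset \bigcup_(w in W i) [set u | adj w u].
    apply/subsetP => u; rewrite inE => /existsP[[p sp]] /= /andP[pp /eqP <-].
    case/lastP: p sp pp => [|p x] sp; first by [].
    rewrite rcons_path last_rcons => /andP[pp px].
    apply/bigcupP; exists (last v p); last by rewrite inE.
    move: sp; rewrite size_rcons eqSS => sp.
    by rewrite inE; apply/existsP; exists (Tuple sp); rewrite /= pp eqxx.
  apply: (leq_trans (subset_leq_card sW)).
  have le_big (I : {set G}) :
      (#|\bigcup_(w in I) [set u | adj w u]| <= \sum_(w in I) d)%N.
    apply: (big_ind2 (fun (A : {set G}) m => (#|A| <= m)%N)) => [|A m B n Am Bn|//].
      by rewrite cards0.
    by apply: leq_trans (leq_add Am Bn); rewrite cardsU leq_subr.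
  apply: (leq_trans (le_big _)).
  by rewrite sum_nat_const expnS mulnC leq_mul2l IH orbT.
rewrite card_sig.
have -> : #|[pred u | u \in ball k v]| = #|\bigcup_(i < k.+1) W i|.
  apply: eq_card => u; rewrite !inE.
  by apply/existsP/bigcupP => [[i h]|[i _]]; rewrite ?inE; exists i; rewrite ?inE.
apply: (big_ind2 (fun (A : {set G}) m => (#|A| <= m)%N)) => [|A m B n Am Bn|//].
  by rewrite cards0.
by apply: leq_trans (leq_add Am Bn); rewrite cardsU leq_subr.
Qed.

Lemma riso_code (N : nat) (H : rgraph) :
  (#|H| <= N)%N -> exists c : code N, riso H (decode c).
Proof.
move=> HN; have HN' : (#|H| < N.+1)%N by [].
pose E := [set [set enum_rank p.1; enum_rank p.2] | p in [set p : H * H | adj p.1 p.2]].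
exists (Tagged (fun n : 'I_N.+1 => ({set {set 'I_n}} * 'I_n)%type)
  (i := Ordinal HN') (E, enum_rank (rg_root H))).
exists (@enum_rank H); split=> //; first exact: enum_rank_bij.
move=> x y /=; apply/idP/idP => [/andP[_ /imsetP[[a b]]]|xy].
  rewrite inE /= => ab eqE.
  have hx : enum_rank x \in [set enum_rank a; enum_rank b] by rewrite -eqE set21.
  have hy : enum_rank y \in [set enum_rank a; enum_rank b] by rewrite -eqE set22.
  have ha : enum_rank a \in [set enum_rank x; enum_rank y] by rewrite eqE set21.
  have hb : enum_rank b \in [set enum_rank x; enum_rank y] by rewrite eqE set22.
  move: hx hy ha hb; rewrite !inE !(inj_eq enum_rank_inj).
  case/orP=> /eqP ->; case/orP=> /eqP -> //; rewrite ?eqxx ?orbb ?orbT /=.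
  - by move=> _ /eqP ba; rewrite ba adj_irr in ab.
  - by move=> _ _; rewrite adj_sym.
  - by move=> /eqP ba; rewrite ba adj_irr in ab.
rewrite /code_adj /= (inj_eq enum_rank_inj); apply/andP; split.
  by apply: contraTneq xy => ->; rewrite adj_irr.
by apply/imsetP; exists (x, y); rewrite ?inE.
Qed.

Lemma disc_type_ex (d k : nat) (G : graph) (v : G) :
  bounded d G -> exists! D : disc_type d k, has_disc_type v D.
Proof.
move=> bG; have [c vc] := riso_code (leq_card_disc k v bG).
pose dom := [set c : code (disc_size d k) | `[< is_disc d k (decode c) >]].
have cdom : c \in dom by rewrite inE; apply/asboolP; exists G, v.
have parP := equivalence_partitionP (@disc_classesP d k).
have [/eqP covP triv _] := and3P parP.
have ccov : c \in cover (disc_classes d k) by rewrite covP.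
exists (Sub (pblock (disc_classes d k) c) (pblock_mem ccov) : disc_type d k); split.
  by exists c => //=; rewrite mem_pblock.
move=> [D DP] [c' /= c'D vc']; apply/val_inj => /=.
rewrite -(def_pblock triv DP c'D); apply: same_pblock => //.
have c'dom : c' \in dom by rewrite /dom -covP; apply/bigcupP; exists D.
rewrite (pblock_equivalence_partition (@disc_classesP d k)) //.
by apply/asboolP; apply: riso_trans (riso_sym vc') vc.
Qed.

(* The number of edges between A and B, for disjoint A and B. *)
Definition edges_between (G : graph) (A B : {set G}) : nat :=
  #|[set p in setX A B | adj p.1 p.2]|.

Section Real.
Variable R : realType.

Definition phi (G : graph) (d : nat) (S : {set G}) : R :=
  (edges_between S (~: S))%:R / (d%:R * #|S|%:R).

Definition freq (G : graph) (d k : nat) (S : {set G}) :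
    {ffun disc_type d k -> R} :=
  [ffun D => #|[set v in S | `[< has_disc_type v D >]]|%:R / #|S|%:R].

Definition norm1 (I : finType) (x : {ffun I -> R}) : R := \sum_i `|x i|.

End Real.

(* Main.v *)
(** Put b ~ 1 / (delta d).  Deleting a set T of at most |V| / b <= delta d |V|
    cut vertices splits G into connected pieces with at most 1 / (delta d)
    vertices, each of which is a component of G or has a neighbour in T.  A set
    X avoiding T sends an edge out of X from each piece that it meets, unless
    the piece is a component of G contained in X.  If phi(X) <= delta^2, there
    are at most delta^2 d |X| such edges, so all but delta |X| vertices of X
    fill whole small components.  Hence it suffices to group the small
    components by size and by number of vertices of each disc type, and all
    other vertices outside T into one class: X then consists of components with
    the same frequencies as its class, up to delta |X| vertices. *)

Require Import Defs.
From HB Require Import structures.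
From mathcomp Require Import all_boot all_order all_algebra.
From mathcomp Require Import boolp reals.

Set Implicit Arguments.
Unset Strict Implicit.
Unset Printing Implicit Defensive.

Import Order.TTheory GRing.Theory Num.Theory.

Local Open Scope ring_scope.

(** * Connected pieces left after deleting few vertices *)

Section Pieces.
Local Open Scope nat_scope.
Variable G : graph.
Implicit Types (A B Q U K T X : {set G}) (P : {set {set G}}) (b : nat).

Definition linked A B := [exists x in A, [exists y in B, adj x y]].

Lemma linkedP A B :
  reflect (exists x y, [/\ x \in A, y \in B & adj x y]) (linked A B).
Proof.
apply: (iffP exists_inP) => [[x xA /exists_inP[y yB xy]]|[x [y [xA yB xy]]]].
  by exists x, y.
by exists x => //; apply/exists_inP; exists y.
Qed.

Lemma linkedC A B : linked A B = linked B A.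
Proof.
by apply/linkedP/linkedP => -[x [y [xA yB xy]]]; exists y, x; rewrite adj_sym.
Qed.

Lemma linkedS A B A' B' :
  A \subset A' -> B \subset B' -> linked A B -> linked A' B'.
Proof.
move=> /subsetP sA /subsetP sB /linkedP[x [y [/sA xA /sB yB xy]]].
by apply/linkedP; exists x, y.
Qed.

(** Connectivity of the induced subgraph, phrased by cuts rather than walks, since what is extracted
    from it is an edge leaving a nonempty proper subset. The empty set counts as connected. *)
Definition connected A :=
  [forall B : {set G}, (B \proper A) && (B != set0) ==> linked B (A :\: B)].

Lemma connectedP A :
  reflect (forall B, B \proper A -> B != set0 -> linked B (A :\: B))
          (connected A).
Proof.
apply: (iffP forallP) => [h B BA B0|h B].
  by have := h B; rewrite BA B0.
by apply/implyP => /andP[]; apply: h.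
Qed.

Lemma connected0 : connected set0.
Proof.
apply/connectedP => B; rewrite properE => /andP[].
by rewrite subset0 => /eqP->; rewrite sub0set.
Qed.

Lemma partition_setU P P' A B :
  partition P A -> partition P' B -> [disjoint A & B] ->
  partition (P :|: P') (A :|: B).
Proof.
move=> /and3P[/eqP cP tP nP] /and3P[/eqP cP' tP' nP'] dAB; apply/and3P; split.
- by rewrite /cover bigcup_setU -!/(cover _) cP cP'.
- by apply: trivIsetU => //; rewrite cP cP'.
- by rewrite inE negb_or nP.
Qed.

Lemma partition1 A : A != set0 -> partition [set A] A.
Proof.
by move=> A0; rewrite /partition cover1 trivIset1 eqxx inE eq_sym A0.
Qed.

Lemma not_connected_split U : ~~ connected U -> exists A B,
  [/\ U = A :|: B, [disjoint A & B], #|A| < #|U|, #|B| < #|U| & ~~ linked A B].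
Proof.
rewrite negb_forall => /existsP[A]; rewrite negb_imply.
move=> /andP[/andP[AU A0] nl]; exists A, (U :\: A).
have sA := proper_sub AU.
have cU : #|U| = #|A| + #|U :\: A| by rewrite -(cardsID A U) (setIidPr sA).
split=> //; last by rewrite cU -[X in X < _]add0n ltn_add2r card_gt0.
- by rewrite -{1}[U](setID U A) (setIidPr sA).
- by rewrite -setI_eq0 setDE setICA setICr setI0.
- exact: proper_card.
Qed.

Lemma unlinkedU A B Q : Q \subset A -> ~~ linked Q (A :\: Q) ->
  ~~ linked A B -> ~~ linked Q ((A :|: B) :\: Q).
Proof.
move=> /subsetP QA nQ nAB; apply/linkedP => -[x [y [xQ]]].
rewrite !inE => /andP[yQ /orP[yA|yB]] xy.
  by case/linkedP: nQ; exists x, y; rewrite inE yQ.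
by case/linkedP: nAB; exists x, y; rewrite QA.
Qed.

Lemma components U : exists P, partition P U /\
  forall Q, Q \in P -> connected Q /\ ~~ linked Q (U :\: Q).
Proof.
have [m] := ubnP #|U|; elim: m U => // m IH U Um.
have [->|U0] := eqVneq U set0.
  exists set0; split=> [|Q]; [by rewrite partition_set0 | by rewrite inE].
have [cU|] := boolP (connected U).
  exists [set U]; split=> [|Q]; first exact: partition1.
  rewrite inE => /eqP->; split=> //; rewrite setDv.
  by apply/linkedP => -[x [y []]]; rewrite inE.
case/not_connected_split=> A [B [eU dAB ltA ltB nAB]].
have [P [pP hP]] := IH _ (leq_trans ltA Um).
have [P' [pP' hP']] := IH _ (leq_trans ltB Um).
exists (P :|: P'); rewrite eU; split; first exact: partition_setU.
move=> Q; rewrite inE => /orP[] QP.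
  have [cQ nQ] := hP _ QP; split=> //.
  exact: unlinkedU (partitionS pP QP) nQ nAB.
have [cQ nQ] := hP' _ QP; split=> //; rewrite setUC.
by apply: unlinkedU (partitionS pP' QP) nQ _; rewrite linkedC.
Qed.

(* For a minimal [K], a component of [K :\ v] with [b] vertices would be a
   smaller choice. *)
Lemma cut_cluster b U K v :
    K \subset U -> v \in K -> connected K -> b <= #|K| ->
    connected (U :\: K) -> (U :\: K == set0) || linked (U :\: K) [set v] ->
  exists (K' : {set G}) (v' : G) (P : {set {set G}}),
  [/\ K' \subset U, v' \in K', b <= #|K'|, connected (U :\: K') &
      (U :\: K' == set0) || linked (U :\: K') [set v']] /\
  partition P (K' :\ v') /\
  (forall Q, Q \in P -> [/\ #|Q| < b, connected Q & linked Q [set v']]).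
Proof.
have [m] := ubnP #|K|; elim: m K v => // m IH K v Km KU vK cK bK cR lR.
have [P [pP hP]] := components (K :\ v).
have QK Q : Q \in P -> Q \subset K :\ v by move=> QP; exact: partitionS pP QP.
have Q0 Q : Q \in P -> Q != set0 by move=> QP; exact: partition_neq0 pP QP.
(* Connectedness of [K] gives an edge from [Q] to the rest of [K]; as [Q] is a component of
   [K :\ v], this edge can only end in [v]. *)
have Qv Q : Q \in P -> linked Q [set v].
  move=> QP; have [_ nQ] := hP _ QP.
  have pQ : Q \proper K by apply: sub_proper_trans (QK _ QP) (properD1 vK).
  have /linkedP[x [y [xQ]]] := connectedP _ cK _ pQ (Q0 _ QP).
  rewrite inE => /andP[yQ yK] xy; apply/linkedP; exists x, y.
  rewrite inE; split=> //; apply: contraNT nQ => yv; apply/linkedP; exists x, y.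
  by rewrite !inE yQ yv yK.
have [/forall_inP small|] := boolP [forall Q in P, #|Q| < b].
  exists K, v, P; split; first by split.
  by split=> // Q QP; have [cQ _] := hP _ QP; split; [exact: small| |exact: Qv].
rewrite negb_forall_in => /exists_inP[Q QP]; rewrite -leqNgt => bQ.
have [cQ nQ] := hP _ QP.
have /linkedP[w [v0 [wQ]]] := Qv _ QP; rewrite inE => /eqP-> wv.
have sQ : Q \subset K by apply: subset_trans (QK _ QP) (subD1set _ _).
have vQ : v \notin Q by apply/negP => /(subsetP (QK _ QP)); rewrite !inE eqxx.
have vU : v \in U :\: Q by rewrite inE vQ (subsetP KU).
apply: (IH Q w) => //.
- apply: leq_trans (_ : #|K| <= m) => //; apply: proper_card.
  by apply: sub_proper_trans (QK _ QP) (properD1 vK).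
- exact: subset_trans sQ KU.
(* Being linked is symmetric, so a set containing [v] can be replaced by its complement in
   [U :\: Q]. *)
- suff main (C : {set G}) : C \subset U :\: Q -> C != set0 -> v \notin C ->
      linked C ((U :\: Q) :\: C).
    apply/connectedP => B BU B0; have [vB|vB] := boolP (v \in B); last first.
      by apply: main => //; apply: proper_sub.
    have eB : B = (U :\: Q) :\: ((U :\: Q) :\: B).
      by rewrite setDDr setDv set0U (setIidPr (proper_sub BU)).
    rewrite linkedC {2}eB.
    apply: main; rewrite ?subsetDl //.
      by rewrite setD_eq0; case/andP: BU.
    by rewrite inE vB.
  move=> CU C0 vC; apply: contraT => nC.
  (* If [C] lies in [K], an edge leaves it inside [K] and cannot enter the component [Q]. Otherwise
     [C] meets the connected set [U :\: K]: it either contains all of it, hence a neighbour of [v],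
     or has an edge leaving it there. *)
  have [CR|[z zCR]] := set_0Vmem (C :&: (U :\: K)).
    have CK : C \subset K.
      apply/subsetP => x xC; apply/negPn/negP => xK.
      have : x \in C :&: (U :\: K).
        by rewrite !inE xC xK; have := subsetP CU _ xC; rewrite inE => /andP[].
      by rewrite CR inE.
    have pC : C \proper K.
      by rewrite properE CK; apply/subsetPn; exists v.
    have /linkedP[x [y [xC]]] := connectedP _ cK _ pC C0.
    rewrite inE => /andP[yC yK] xy.
    have xQ : x \notin Q by have := subsetP CU _ xC; rewrite inE => /andP[].
    have [yQ|yQ] := boolP (y \in Q).
      case/linkedP: nQ; exists y, x; rewrite adj_sym !inE xQ (subsetP CK) //.
      by rewrite andbT; split=> //; apply: contraNneq vC => <-.
    by case/linkedP: nC; exists x, y; rewrite !inE yC yQ (subsetP KU).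
  have lRv : linked (U :\: K) [set v].
    case/orP: lR => // /eqP R0; move: zCR; rewrite R0 inE => /andP[_].
    by rewrite inE.
  have [RC|RC] := boolP (U :\: K \subset C).
    case/linkedP: nC; have /linkedP[x [y [xR]]] := lRv.
    rewrite inE => /eqP-> xv; exists x, v.
    split=> //; first exact: (subsetP RC).
    by rewrite inE vC.
  have pB : C :&: (U :\: K) \proper U :\: K.
    rewrite properE subsetIr; apply: contra RC => /subset_trans-> //.
    exact: subsetIl.
  have nB : C :&: (U :\: K) != set0 by apply/set0Pn; exists z.
  have /linkedP[x [y []]] := connectedP _ cR _ pB nB.
  rewrite inE => /andP[xC _]; rewrite !inE => /andP[yC /andP[yK yU]] xy.
  case/linkedP: nC; exists x, y; rewrite !inE yU; split=> //.
  have -> : y \notin Q by apply: contra yK => /(subsetP sQ).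
  by move: yC; rewrite (negPf yK) yU !andbT => ->.
- apply/orP; right; apply/linkedP; exists v, w; rewrite inE eqxx adj_sym.
  by split.
Qed.

Lemma setDU2 A B T T' :
  T \subset A -> T' \subset B -> [disjoint A & B] ->
  (A :|: B) :\: (T :|: T') = (A :\: T) :|: (B :\: T').
Proof.
move=> sT sT' dAB; rewrite setDUl !setDUr.
have dB : [disjoint A & T'] by exact: disjointWr sT' dAB.
have dA : [disjoint B & T] by rewrite disjoint_sym; exact: disjointWl sT dAB.
rewrite (setDidPl dA) (setDidPl dB).
by rewrite (setIidPl (subsetDl _ _)) (setIidPr (subsetDl _ _)).
Qed.

(** Each deleted vertex is charged to its own cluster of at least [b] vertices, and the clusters are
    disjoint; this bounds [#|T|]. The pieces of a cluster all touch its deleted vertex, and the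
    induction continues on the connected remainder. *)
Lemma decomposition b U : 0 < b -> exists T P,
  [/\ T \subset U, partition P (U :\: T) & #|T| * b <= #|U|] /\
  (forall Q, Q \in P ->
     [/\ #|Q| < b, connected Q & ~~ linked Q (U :\: Q) || linked Q T]).
Proof.
move=> b0; have [m] := ubnP #|U|; elim: m U => // m IH U Um.
have [->|U0] := eqVneq U set0.
  exists set0, set0; rewrite setDv cards0; split; last by move=> Q; rewrite inE.
  by rewrite partition_set0.
have [cU|] := boolP (connected U); last first.
  case/not_connected_split=> A [B [eU dAB ltA ltB nAB]].
  have [T [P [[sT pP cT] hP]]] := IH _ (leq_trans ltA Um).
  have [T' [P' [[sT' pP' cT'] hP']]] := IH _ (leq_trans ltB Um).
  exists (T :|: T'), (P :|: P'); rewrite eU; split; first split.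
  - exact: setUSS.
  - rewrite (setDU2 sT sT' dAB); apply: partition_setU => //.
    exact: disjointWl (subsetDl _ _) (disjointWr (subsetDl _ _) dAB).
  - rewrite [#|A :|: B|]cardsU (disjoint_setI0 dAB) cards0 subn0.
    apply: leq_trans (leq_add cT cT').
    by rewrite -mulnDl leq_mul2r cardsU leq_subr orbT.
  move=> Q; rewrite inE => /orP[] QP.
    have [bQ cQ lQ] := hP _ QP; split=> //; apply/orP; case/orP: lQ => lQ.
      left; apply: unlinkedU lQ nAB.
      exact: subset_trans (partitionS pP QP) (subsetDl _ _).
    by right; apply: linkedS lQ => //; apply: subsetUl.
  have [bQ cQ lQ] := hP' _ QP; split=> //; apply/orP; case/orP: lQ => lQ.
    left; rewrite setUC; apply: unlinkedU lQ _; last by rewrite linkedC.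
    exact: subset_trans (partitionS pP' QP) (subsetDl _ _).
  by right; apply: linkedS lQ => //; apply: subsetUr.
have [ltb|leb] := ltnP #|U| b.
  exists set0, [set U]; rewrite setD0 sub0set cards0; split.
    by split=> //; exact: partition1.
  move=> Q; rewrite inE => /eqP->; split=> //; rewrite setDv.
  by apply/orP; left; apply/linkedP => -[x [y []]]; rewrite inE.
have [v vU] := set0Pn _ U0.
(* The search for a cluster starts from [K = U], where the conditions on the remainder hold
   trivially. *)
have cD : connected (U :\: U) by rewrite setDv; exact: connected0.
have lD : (U :\: U == set0) || linked (U :\: U) [set v] by rewrite setDv eqxx.
have [K [w [P [[sK wK bK cR lR] [pP hP]]]]] :=
  cut_cluster (subxx U) vU cU leb cD lD.
have cardU : #|U| = #|K| + #|U :\: K| by rewrite -(cardsID K U) (setIidPr sK).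
have dKR : [disjoint K & U :\: K].
  by rewrite -setI_eq0 setDE setICA setICr setI0.
have ltR : #|U :\: K| < m.
  move: Um; rewrite cardU ltnS; apply: leq_trans.
  by rewrite -[X in X < _]add0n ltn_add2r; apply: leq_trans bK.
have [T' [P' [[sT' pP' cT'] hP']]] := IH _ ltR.
have wT' : w \notin T' by apply/negP => /(subsetP sT'); rewrite inE wK.
exists (w |: T'), (P :|: P'); split; first split.
- by rewrite subUset sub1set (subsetP sK) // (subset_trans sT') // subsetDl.
- have -> : U :\: (w |: T') = (K :\ w) :|: ((U :\: K) :\: T').
    by rewrite -setDU2 ?sub1set ?dKR // -{1}(setIidPr sK) setID.
  apply: partition_setU => //.
  apply: disjointWl (subsetDl _ _) (disjointWr (subsetDl _ _) dKR).
- by rewrite cardsU1 wT' mulnDl mul1n cardU leq_add.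
move=> Q; rewrite inE => /orP[] QP.
  have [bQ cQ lQ] := hP _ QP; split=> //; apply/orP; right.
  by apply: linkedS lQ => //; apply: subsetUl.
have [bQ cQ lQ] := hP' _ QP; split=> //; apply/orP; right.
case/orP: lQ => lQ; last by apply: linkedS lQ => //; apply: subsetUr.
have QR : Q \subset U :\: K.
  exact: subset_trans (partitionS pP' QP) (subsetDl _ _).
have Q0 : Q != set0.
  by case/and3P: pP' => _ _ nP'; apply: contraNneq nP' => <-.
(* Since [U :\: K] is connected, a piece unlinked to the rest of it is all of it, and [lR] then
   supplies the neighbour [w] in the deleted set. *)
have QeR : Q = U :\: K.
  apply/eqP; apply: contraNT lQ => QneR.
  by apply: (connectedP _ cR) => //; rewrite properEneq QneR.
case/orP: lR => [/eqP R0|]; first by rewrite QeR R0 eqxx in Q0.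
by rewrite -QeR => lQw; apply: linkedS lQw => //; apply: subsetUl.
Qed.

End Pieces.

(** * Frequencies of types and their perturbation *)

Section TypeCounts.
Local Open Scope nat_scope.
Variables (V I : finType) (ty : V -> I).
Implicit Types (A X W S : {set V}) (P : {set {set V}}).

Definition count_type A (D : I) : nat := #|[set v in A | ty v == D]|.

Lemma count_typeE A D : count_type A D = \sum_(v in A) (ty v == D).
Proof.
rewrite /count_type -sum1_card.
rewrite [LHS](eq_bigl (fun v => (v \in A) && (ty v == D))).
  by rewrite big_mkcondr; apply: eq_bigr => v _; case: eqP.
by move=> v; rewrite inE.
Qed.

Lemma sum_count_type A : \sum_D count_type A D = #|A|.
Proof.
under eq_bigr do rewrite count_typeE.
rewrite exchange_big -sum1_card; apply: eq_bigr => v _.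
rewrite (bigD1 (ty v)) //= eqxx big1 // => D.
by rewrite eq_sym => /negPf->.
Qed.

Lemma count_type_partition P A D :
  partition P A -> count_type A D = \sum_(Q in P) count_type Q D.
Proof.
move=> pP; rewrite count_typeE (set_partition_big _ pP).
by apply: eq_bigr => Q _; rewrite count_typeE.
Qed.

(** Both sides expand to double sums over [P] and [P'] that agree term by term. The equality of
    frequencies is cross-multiplied so that it also covers an empty [A]. *)
Lemma count_type_proportional P P' A S D :
    partition P A -> partition P' S ->
    (forall Q Q', Q \in P -> Q' \in P' ->
       #|Q| = #|Q'| /\ count_type Q D = count_type Q' D) ->
  count_type A D * #|S| = count_type S D * #|A|.
Proof.
move=> pP pP' eqQ; rewrite (count_type_partition _ pP) (card_partition pP').
rewrite (count_type_partition _ pP') (card_partition pP) !big_distrlr /=.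
rewrite [RHS]exchange_big /=; apply: eq_bigr => Q QP; apply: eq_bigr => Q' QP'.
by have [-> ->] := eqQ _ _ QP QP'.
Qed.

(** The part [W] has the frequencies of [S], so only [X :\: W] contributes to the difference. Its
    own counts and the share that [S] would predict for it each sum to [#|X :\: W| / #|X|], which
    gives the factor 2. *)
Lemma frequency_close (R : realType) X W S (e : R) :
    W \subset X -> X != set0 -> S != set0 ->
    (forall D, count_type W D * #|S| = count_type S D * #|W|) ->
    (#|X :\: W|%:R <= e * #|X|%:R)%R ->
  (\sum_D `|(count_type X D)%:R / #|X|%:R - (count_type S D)%:R / #|S|%:R|
     <= 2 * e :> R)%R.
Proof.
move=> WX X0 S0 eqWS leXW.
have x0 : (0 < #|X|%:R :> R)%R by rewrite ltr0n card_gt0.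
have s0 : (0 < #|S|%:R :> R)%R by rewrite ltr0n card_gt0.
have cX D : count_type X D = count_type W D + count_type (X :\: W) D.
  rewrite !count_typeE (big_setID W) /=.
  by rewrite (setIidPr WX).
have cardX : #|X| = #|W| + #|X :\: W| by rewrite -(cardsID W X) (setIidPr WX).
have termE D : ((count_type X D)%:R / #|X|%:R - (count_type S D)%:R / #|S|%:R =
    ((count_type (X :\: W) D)%:R
      - (count_type S D)%:R / #|S|%:R * #|X :\: W|%:R) / #|X|%:R :> R)%R.
  have wE : ((count_type W D)%:R =
      (count_type S D)%:R / #|S|%:R * #|W|%:R :> R)%R.
    apply: (mulIf (lt0r_neq0 s0)); rewrite -natrM eqWS natrM.
    by rewrite mulrAC divfK ?lt0r_neq0.
  apply: (mulIf (lt0r_neq0 x0)); rewrite mulrBl !divfK ?lt0r_neq0 //.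
  by rewrite cX natrD wE cardX natrD mulrDr opprD addrACA subrr add0r.
apply: (@le_trans _ _ (\sum_D ((count_type (X :\: W) D)%:R / #|X|%:R
    + (count_type S D)%:R / #|S|%:R * (#|X :\: W|%:R / #|X|%:R)))%R).
  apply: ler_sum => D _; rewrite termE mulrBl (le_trans (ler_normB _ _)) //.
  by rewrite [X in (_ <= _ + X)%R]mulrA !ger0_norm ?mulr_ge0 ?invr_ge0 ?ler0n.
rewrite big_split /= -!mulr_suml -!natr_sum !sum_count_type.
by rewrite divff ?lt0r_neq0 // mul1r mulrDl mul1r lerD // ler_pdivrMr.
Qed.

End TypeCounts.

(** * Counting the edges that leave a set *)

(** Sending an edge to the piece that contains its endpoint in [X] hits every member of [B]. *)
Lemma card_leaving_pieces (G : graph) (B : {set {set G}}) (X : {set G}) :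
    trivIset B -> (forall Q, Q \in B -> linked (X :&: Q) (~: X)) ->
  (#|B| <= edges_between X (~: X))%N.
Proof.
move=> tB lB; rewrite /edges_between.
set E := [set p in _ | _].
apply: leq_trans (leq_imset_card (fun p : G * G => pblock B p.1) (mem E)).
apply/subset_leq_card/subsetP => Q QB.
have /linkedP[x [y [xXQ yX xy]]] := lB _ QB.
move: xXQ; rewrite inE => /andP[xX xQ].
apply/imsetP; exists (x, y); last by rewrite /= (def_pblock tB QB xQ).
by rewrite !inE /= xX xy andbT -in_setC.
Qed.

Lemma bounded0_adj (G : graph) (x y : G) : bounded 0 G -> ~~ adj x y.
Proof.
move=> bG; apply/negP => xy.
have : (degree x <= 0)%N.
  by apply: leq_trans bG; apply: (leq_bigmax (F := @degree G)).
by rewrite leqn0 cards_eq0 => /eqP/setP/(_ y); rewrite !inE xy.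
Qed.

Lemma phi_le_edges (R : realType) (G : graph) (d : nat) (X : {set G}) (e : R) :
    bounded d G -> X != set0 -> phi R d X <= e ->
  (edges_between X (~: X))%:R <= e * (d%:R * #|X|%:R).
Proof.
move=> bG X0; have x0 : (0 < #|X|)%N by rewrite card_gt0.
(* For [d = 0] the denominator of [phi] vanishes; this case is settled by the absence of edges. *)
case: d bG => [|d] bG; last first.
  by rewrite /phi ler_pdivrMr // mulr_gt0 // ltr0n.
rewrite mul0r mulr0 /edges_between => _.
rewrite (_ : [set p in _ | _] = set0) ?cards0 //; apply/setP => p.
by rewrite !inE (negPf (bounded0_adj _ _ bG)) andbF.
Qed.

(** * Classes of pieces with equal labels *)

Section LabelClasses.
Variables (G : graph) (d k s : nat) (T : {set G}) (P : {set {set G}}).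
Variable ty : G -> disc_type d k.
Hypothesis pP : partition P (~: T).

Let label_type : finType := option ('I_s.+1 * {ffun disc_type d k -> 'I_s.+1}).

(** [None] is shared by all pieces with an edge leaving them, be it to [T] or to another piece. The
    other pieces record their size and type counts. On [T] the block is empty and the value is junk,
    so [label_class] excludes [T]. *)
Definition piece_label (v : G) : label_type :=
  let Q := pblock P v in
  if linked Q (~: Q) then None
  else Some (inord #|Q|, [ffun D => inord (count_type ty Q D)]).

Definition label_class (l : label_type) : {set G} :=
  [set v in ~: T | piece_label v == l].

Lemma piece_label_in Q v : Q \in P -> v \in Q -> piece_label v =
  if linked Q (~: Q) then None
  else Some (inord #|Q|, [ffun D => inord (count_type ty Q D)]).
Proof.
move=> QP vQ; rewrite /piece_label.
by rewrite (def_pblock (partition_trivIset pP) QP vQ).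
Qed.

Lemma piece_of v : v \notin T -> exists2 Q, Q \in P & v \in Q.
Proof.
move=> vT; have : v \in cover P by rewrite (cover_partition pP) inE.
by case/bigcupP=> Q QP vQ; exists Q.
Qed.

Lemma label_class_partition l :
  partition [set Q in P | Q \subset label_class l] (label_class l).
Proof.
apply/and3P; split.
- apply/eqP/setP => v; apply/bigcupP/idP => [[Q]|vl].
    by rewrite inE => /andP[_ /subsetP]; apply.
  have vT : v \notin T by move: vl; rewrite !inE => /andP[].
  have [Q QP vQ] := piece_of vT; exists Q => //; rewrite inE QP.
  apply/subsetP => w wQ; rewrite inE (subsetP (partitionS pP QP)) //=.
  rewrite (piece_label_in QP wQ) -(piece_label_in QP vQ).
  by move: vl; rewrite inE => /andP[].
- apply: trivIsetS (partition_trivIset pP).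
  by apply/subsetP => Q; rewrite inE => /andP[].
- by rewrite inE (partition0 pP).
Qed.

(** An edge between two different pieces leaves both, so both are labelled [None]; inside one piece
    the label is constant. *)
Lemma label_class_sep l l' x y :
  x \in label_class l -> y \in label_class l' -> l != l' -> ~~ adj x y.
Proof.
rewrite !inE => /andP[xT /eqP lx] /andP[yT /eqP ly] ll'.
have [Q QP xQ] := piece_of xT; have [Q' QP' yQ'] := piece_of yT.
apply: contra ll' => xy; rewrite -lx -ly.
have [yQ|yQ] := boolP (y \in Q).
  by rewrite (piece_label_in QP xQ) (piece_label_in QP yQ).
have xQ' : x \notin Q'.
  apply: contra yQ => xQ'.
  rewrite -(def_pblock (partition_trivIset pP) QP xQ).
  by rewrite (def_pblock (partition_trivIset pP) QP' xQ').
rewrite (piece_label_in QP xQ) (piece_label_in QP' yQ').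
have -> : linked Q (~: Q) by apply/linkedP; exists x, y; rewrite inE.
suff -> : linked Q' (~: Q') by [].
by apply/linkedP; exists y, x; rewrite inE adj_sym.
Qed.

Hypothesis sizeP : forall Q, Q \in P -> (#|Q| <= s)%N.
Hypothesis connP : forall Q, Q \in P -> connected Q.
Hypothesis linkP : forall Q, Q \in P -> ~~ linked Q (~: Q) || linked Q T.

(** The unlinked pieces contained in [X] have the frequencies of the whole class. Every other piece
    that meets [X] sends an edge out of [X] and holds at most [s] vertices, so these pieces cover at
    most [e * #|X|] vertices of [X]. *)
Lemma label_class_close (R : realType) (e : R) l (X : {set G}) :
    X \subset label_class l -> X != set0 ->
    s%:R * (edges_between X (~: X))%:R <= e * #|X|%:R ->
  \sum_D `|(count_type ty X D)%:R / #|X|%:R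
     - (count_type ty (label_class l) D)%:R / #|label_class l|%:R| <= 2 * e.
Proof.
move=> Xl X0 leX.
have tP := partition_trivIset pP.
pose PW := [set Q in P | (Q \subset X) && ~~ linked Q (~: Q)].
have sPW : PW \subset P by apply/subsetP => Q; rewrite inE => /andP[].
have XT : X \subset ~: T.
  by apply: subset_trans Xl _; apply/subsetP => v; rewrite inE => /andP[].
apply: (frequency_close (W := cover PW)) => //.
- by apply/bigcupsP => Q; rewrite inE => /and3P[].
- by apply: contraNneq X0 => l0; rewrite -subset0 -l0.
- move=> D; apply: count_type_proportional (label_class_partition l) _.
    apply/and3P; split=> //; first exact: trivIsetS sPW tP.
    by rewrite inE (partition0 pP).
  move=> Q Q'; rewrite inE => /and3P[QP QX nQ]; rewrite inE => /andP[QP' Ql'].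
  have [v vQ] := set0Pn _ (partition_neq0 pP QP).
  have [v' vQ'] := set0Pn _ (partition_neq0 pP QP').
  have : piece_label v = piece_label v'.
    have := subsetP Xl _ (subsetP QX _ vQ); have := subsetP Ql' _ vQ'.
    by rewrite !inE => /andP[_ /eqP->] /andP[_ /eqP->].
  rewrite (piece_label_in QP vQ) (piece_label_in QP' vQ') (negPf nQ).
  (* The unlinked piece [Q] has a [Some] label, so [Q'] has the same one. If [PW] is empty, for
     instance when [l] is [None], the claim is vacuous. *)
  case: ifP => // _ [eQ /ffunP/(_ D)]; rewrite !ffunE => eD.
  (* Sizes and counts are at most [s], hence [inord] identifies no two of them. *)
  have leD A : A \in P -> (count_type ty A D < s.+1)%N.
    move=> AP; rewrite ltnS (leq_trans _ (sizeP AP)) // subset_leq_card //.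
    by apply/subsetP => w; rewrite inE => /andP[].
  split.
    by rewrite -[LHS](@inordK s) ?ltnS ?sizeP // eQ inordK ?ltnS ?sizeP.
  by rewrite -[LHS](@inordK s) ?leD // eD inordK ?leD.
apply: le_trans leX; rewrite -natrM ler_nat.
pose B := [set Q in P | linked (X :&: Q) (~: X)].
have sB : B \subset P by apply/subsetP => Q; rewrite inE => /andP[].
have leB : (#|B| <= edges_between X (~: X))%N.
  apply: card_leaving_pieces; first exact: trivIsetS sB tP.
  by move=> Q; rewrite inE => /andP[].
apply: leq_trans (_ : s * #|B| <= _)%N; last by rewrite leq_mul2l leB orbT.
apply: leq_trans (_ : #|cover B| <= _)%N; last first.
  apply: leq_trans (leq_card_cover B) _.
  rewrite mulnC -sum_nat_const; apply: leq_sum => Q QB.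
  by apply: sizeP; apply: subsetP QB.
apply/subset_leq_card/subsetP => v; rewrite inE => /andP[vW vX].
have vT : v \notin T by have := subsetP XT _ vX; rewrite inE.
have [Q QP vQ] := piece_of vT; apply/bigcupP; exists Q => //; rewrite inE QP /=.
(* A piece inside [X] but outside [PW] is linked, so it has a neighbour in [T], which is disjoint
   from [X]. A piece only partly in [X] has an edge across by connectedness. *)
have [QX|QX] := boolP (Q \subset X).
  have lQ : linked Q (~: Q).
    apply: contraNT vW => nQ; apply/bigcupP; exists Q => //.
    by rewrite inE QP QX.
  have := linkP QP; rewrite lQ /= (setIidPr QX); apply: linkedS => //.
  by rewrite subsetC.
have pQ : X :&: Q \proper Q.
  rewrite properE subsetIr; apply: contra QX => /subset_trans-> //.
  exact: subsetIl.
have nQ : X :&: Q != set0 by apply/set0Pn; exists v; rewrite inE vX.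
apply: linkedS (connectedP _ (connP QP) _ pQ nQ) => //.
by apply/subsetP => w; rewrite !inE => /andP[wXQ wQ]; apply: contra wXQ => ->.
Qed.

End LabelClasses.

(** * Choice of the piece size *)

Lemma bounded0_connected_card (G : graph) (A : {set G}) :
  bounded 0 G -> connected A -> (#|A| <= 1)%N.
Proof.
move=> bG /connectedP cA; rewrite leqNgt; apply/negP => A1.
have [x xA] : exists x, x \in A by apply/card_gt0P; apply: leq_trans A1.
have : linked [set x] (A :\: [set x]).
  apply: cA; last by apply/set0Pn; exists x; rewrite inE.
  by rewrite properEcard sub1set xA cards1.
by case/linkedP=> y [z [_ _ yz]]; have := bounded0_adj y z bG; rewrite yz.
Qed.

(* For [d = 0] the inverse would be [0], but pieces are single vertices. *)
Definition piece_size (R : realType) (delta : R) (d : nat) : nat :=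
  if d == 0%N then 1%N else Num.truncn (delta * d%:R)^-1.

Lemma bounded_decomposition (R : realType) (G : graph) (d : nat) (delta : R) :
    bounded d G -> 0 < delta ->
  exists (T : {set G}) (P : {set {set G}}),
    [/\ partition P (~: T), #|T|%:R <= delta * d%:R * #|G|%:R &
        forall Q, Q \in P -> [/\ (#|Q| <= piece_size delta d)%N, connected Q &
          ~~ linked Q (~: Q) || linked Q T]].
Proof.
rewrite /piece_size; case: d => [|d] bG delta0 /=.
  (* For [d = 0] the set [T] must be empty; the threshold [#|G| + 1] forces this. *)
  have [T [P [[_ pP cT] hP]]] := decomposition [set: G] (ltn0Sn #|G|).
  have T0 : T = set0.
    apply/eqP; rewrite -cards_eq0 -leqn0 leqNgt; apply/negP => T0.
    by have := leq_trans (leq_pmull _ T0) cT; rewrite cardsT ltnn.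
  exists T, P; rewrite -setTD; split=> //.
    by rewrite T0 cards0 !mulr0 mul0r.
  move=> Q QP; have [_ cQ lQ] := hP _ QP; rewrite -setTD; split=> //.
  exact: bounded0_connected_card bG cQ.
set x := delta * _; have x0 : 0 < x by rewrite mulr_gt0 ?ltr0n.
(* The threshold [b] is the successor of the truncation: it exceeds [x^-1], which bounds [T], while
   pieces with fewer than [b] vertices have at most [piece_size] many. *)
have [T [P [[_ pP cT] hP]]] :=
  decomposition [set: G] (ltn0Sn (Num.truncn x^-1)).
exists T, P; rewrite -setTD; split=> // [|Q QP]; last first.
  by have [bQ cQ lQ] := hP _ QP; rewrite -setTD.
rewrite mulrC -ler_pdivrMr // -cardsT.
apply: le_trans (_ : (#|T| * (Num.truncn x^-1).+1)%:R <= _);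
  last by rewrite ler_nat.
rewrite natrM; apply: ler_wpM2l => //; apply: ltW.
exact: truncnS_gt.
Qed.

Lemma piece_size_bound (R : realType) (delta : R) (d : nat) :
  0 < delta -> (piece_size delta d)%:R * (delta * d%:R) <= 1.
Proof.
rewrite /piece_size; case: d => [|d] delta0 /=; first by rewrite !mulr0.
set x := delta * _; have x0 : 0 < x by rewrite mulr_gt0 ?ltr0n.
by rewrite -ler_pdivlMr // mul1r truncn_le invr_ge0 ltW.
Qed.

(** * Assembling the partition *)

Theorem theorem5p1 (R : realType) :
  exists f : R -> nat -> nat -> nat,
  forall (G : graph) (d k : nat) (delta : R),
    bounded d G -> 0 < delta -> delta <= 1 ->
  exists (r : nat) (S : 'I_r -> {set G}) (T : {set G}),
    (r <= f delta d k)%N /\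
    [/\ forall i, S i != set0,
        forall i j, i != j -> [disjoint S i & S j],
        forall i, [disjoint S i & T] &
        \bigcup_i S i :|: T = [set: G]] /\
    [/\ forall i j, i != j ->
          forall x y, x \in S i -> y \in S j -> ~~ adj x y,
        #|T|%:R <= delta * d%:R * #|G|%:R &
        forall i (X : {set G}), X \subset S i -> X != set0 ->
          phi R d X <= delta ^+ 2 ->
          norm1 (freq R d k X - freq R d k (S i)) <= 3 * delta].
Proof.
(* The bound is the number of possible labels, which does not depend on [G]. *)
exists (fun delta d k => #|{: option ('I_(piece_size delta d).+1 *
  {ffun disc_type d k -> 'I_(piece_size delta d).+1})}|).
move=> G d k delta bG delta0 delta1.
have [T [P [pP cT hP]]] := bounded_decomposition bG delta0.
have [ty tyP] : exists ty : G -> disc_type d k,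
    forall v D, `[< has_disc_type v D >] = (ty v == D).
  have /choice[ty tyP] v := disc_type_ex k v bG.
  exists ty => v D; have [hv uv] := tyP v.
  by apply/asboolP/eqP => [/uv//|<-].
set s := piece_size delta d in hP *.
pose cls := @label_class G d k s T P ty.
(* Only labels that occur are kept, so that every [S i] is nonempty. *)
pose L := [set l | cls l != set0].
pose S (i : 'I_#|L|) := cls (enum_val i).
have Sneq (i j : 'I_#|L|) : i != j -> enum_val i != enum_val j.
  by rewrite (inj_eq enum_val_inj).
exists #|L|, S, T; split; first exact: max_card.
split; split.
- by move=> i; have := enum_valP i; rewrite inE.
- move=> i j ij; rewrite -setI_eq0; apply/eqP/setP => v; rewrite !inE.
  apply/negP => /andP[/andP[_ /eqP li] /andP[_ /eqP lj]].
  by have := Sneq _ _ ij; rewrite -li -lj eqxx.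
- move=> i; rewrite -setI_eq0; apply/eqP/setP => v; rewrite !inE.
  by case: (v \in T); rewrite ?andbF.
- apply/setP => v; rewrite !inE.
  have [vT|vT] := boolP (v \in T); first by rewrite orbT.
  pose l := @piece_label G d k s P ty v.
  have vl : v \in cls l by rewrite !inE vT eqxx.
  have lL : l \in L by rewrite inE; apply/set0Pn; exists v.
  rewrite orbF; apply/bigcupP; exists (enum_rank_in lL l) => //.
  by rewrite /S enum_rankK_in.
- by move=> i j ij x y xS yS; exact: (label_class_sep pP xS yS (Sneq _ _ ij)).
- exact: cT.
move=> i X XS X0 phiX.
have freqE (A : {set G}) D :
    freq R d k A D = (count_type ty A D)%:R / #|A|%:R.
  rewrite ffunE /count_type; congr (_%:R / _); apply: eq_card => v.
  by rewrite !inE tyP.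
(* The argument gives [2 * delta], which is then relaxed to [3 * delta]. *)
apply: (@le_trans _ _ (2 * delta)); last by rewrite ler_pM2r ?ler_nat.
rewrite /norm1; under eq_bigr => D _.
  rewrite ffunE [X in _ + X]ffunE !freqE; over.
apply: (label_class_close pP) => //; try by move=> Q /hP[].
have leX : (edges_between X (~: X))%:R <= delta * d%:R * (delta * #|X|%:R).
  by rewrite mulrACA -expr2; exact: phi_le_edges bG X0 phiX.
(* One factor [delta * d] is absorbed by the piece size, as [s * (delta * d) <= 1]; the other factor
   [delta] remains as the error. *)
apply: le_trans (ler_wpM2l (ler0n _ _) leX) _; rewrite [leLHS]mulrA.
by rewrite ler_piMl ?piece_size_bound // mulr_ge0 // ltW.
Qed.
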